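(* Let $k$ be an infinite $C_1$ field with $\operatorname{char}k\ne2$. A general conic bundle $\mathcal{Q}^1\to\mathbb{P}^1$ of type $(3,1,0)$ over $k$ is unirational over $k$.
   Context: A conic bundle of type $(3,1,0)$ is $$\mathcal{Q}^1=\{\sigma_{0,0}y_0^2+\sigma_{0,1}y_0y_1+\sigma_{0,2}y_0y_2+\sigma_{1,1}y_1^2+\sigma_{1,2}y_1y_2+\sigma_{2,2}y_2^2=0\}\subset\mathcal{T}_{3,1,0}=\mathbb{P}(\mathcal{O}_{\mathbb{P}^1}(3)\oplus\mathcal{O}_{\mathbb{P}^1}(1)\oplus\mathcal{O}_{\mathbb{P}^1}),$$ with $\sigma_{0,0},\sigma_{0,1},\sigma_{0,2},\sigma_{1,1},\sigma_{1,2},\sigma_{2,2}$ homogeneous in $k[x_0,x_1]$ of degrees $6,4,3,2,1,0$ respectively, where $\mathcal{T}_{3,1,0}$ is the toric variety with Cox ring $k[x_0,x_1,y_0,y_1,y_2]$, $\deg x_i=(1,0)$, $\deg y_0=(-3,1)$, $\deg y_1=(-1,1)$, $\deg y_2=(0,1)$, irrelevant ideal $(x_0,x_1)\cap(y_0,y_1,y_2)$. General means corresponding to a general point (i.e. a point of some nonempty Zariski open subset) of the projective space of tuples $(\sigma_{i,j})$ up to scaling. A field is $C_1$ if every homogeneous form of degree $d>0$ in more than $d$ variables has a nontrivial zero. *)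

(* Defs.v *)
From HB Require Import structures.
From mathcomp Require Import all_boot all_order all_algebra.
From mathcomp Require Import mpoly.

Set Implicit Arguments.
Unset Strict Implicit.
Unset Printing Implicit Defensive.

Import GRing.Theory.
Local Open Scope ring_scope.

Definition infinite_field (k : fieldType) : Prop :=
  forall s : seq k, exists x : k, x \notin s.

Definition C1_field (k : fieldType) : Prop :=
  forall (n d : nat) (p : {mpoly k[n]}),
    (0 < d < n)%N -> p \is d.-homog ->
    exists v : 'I_n -> k, (exists i, v i != 0) /\ p.@[v] = 0.

(* Zariski topology on the k-points of projective n-space. Points are
   given by nonzero vectors of homogeneous coordinates; an open set is the
   complement of the common zeros of a set of forms, hence is automatically
   invariant under scaling. *)

Definition proj_point (k : fieldType) (n : nat) (v : 'I_n.+1 -> k) : Prop :=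
  exists i, v i != 0.

Definition zariski_open (k : fieldType) (n : nat)
    (U : ('I_n.+1 -> k) -> Prop) : Prop :=
  exists2 I : {mpoly k[n.+1]} -> Prop,
    (forall F, I F -> exists d : nat, F \is d.-homog) &
    (forall v, U v <-> proj_point v /\ exists2 F, I F & F.@[v] != 0).

(* The toric variety T_{3,1,0}: its Cox ring k[x_0,x_1,y_0,y_1,y_2] is
   {mpoly k[2 + 3]}, the variables x_i are indexed by [xv i] and the y_j by [yv j]. *)

Definition xv (i : 'I_2) : 'I_(2 + 3) := lshift 3 i.
Definition yv (j : 'I_3) : 'I_(2 + 3) := rshift 2 j.

Definition twist (j : 'I_3) : nat := tnth [tuple 3; 1; 0]%N j.

(* deg x_i = (1, 0) and deg y_j = (- twist j, 1). *)
Definition cox_deg (m : 'X_{1..2 + 3}) : int * int :=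
  (\sum_(i < 2) (m (xv i))%:Z - \sum_(j < 3) (twist j * m (yv j))%:Z,
   \sum_(j < 3) (m (yv j))%:Z).

Definition bihomog (k : fieldType) (F : {mpoly k[2 + 3]}) : Prop :=
  exists D : int * int, forall m, m \in msupp F -> cox_deg m = D.

(* Being outside the zero locus of the irrelevant ideal
   (x_0,x_1) /\ (y_0,y_1,y_2). *)
Definition relevant (A : zmodType) (v : 'I_(2 + 3) -> A) : Prop :=
  (exists i, v (xv i) != 0) /\ (exists j, v (yv j) != 0).

(* Cox coordinates, with values in a field extension [iota : k -> L], of an
   L-point of the hypersurface Q = 0 of T_{3,1,0}. *)
Definition point_of (k : fieldType) (Q : {mpoly k[2 + 3]})
    (L : fieldType) (iota : {rmorphism k -> L}) (v : 'I_(2 + 3) -> L) : Prop :=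
  relevant v /\ mmap iota v Q = 0.

(* F vanishes at every point of the hypersurface Q = 0. Points over all field
   extensions are used because the k-points need not be dense. *)
Definition vanishes_on (k : fieldType) (Q F : {mpoly k[2 + 3]}) : Prop :=
  forall (L : fieldType) (iota : {rmorphism k -> L}) (v : 'I_(2 + 3) -> L),
    point_of Q iota v -> mmap iota v F = 0.

(* Rational maps from P^n to the hypersurface Q = 0, in Cox coordinates: forms
   phi in t_0..t_n, of degree d for the x_i and e - twist j * d for the y_j, so
   that scaling t by c acts on phi through the element (c^d, c^e) of the torus
   defining T_{3,1,0}. Since k[t_0..t_n] is factorial, every rational map is of
   this form; multiplying the y_j by a common form makes e as large as wanted. *)
Definition rational_map (k : fieldType) (Q : {mpoly k[2 + 3]}) (n : nat)
    (phi : 'I_(2 + 3) -> {mpoly k[n.+1]}) : Prop :=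
  [/\ exists d e : nat,
        (forall i, phi (xv i) \is d.-homog) /\
        (forall j, (twist j * d <= e)%N /\
                   phi (yv j) \is (e - twist j * d).-homog),
      relevant phi
    & mmap (@mpolyC n.+1 k) phi Q = 0].

(* The closed subsets of T_{3,1,0} are the zero loci of bihomogeneous elements
   of the Cox ring, so the image of phi is dense in the hypersurface Q = 0 when
   every such element vanishing on the image vanishes on the hypersurface. *)
Definition dominant (k : fieldType) (Q : {mpoly k[2 + 3]}) (n : nat)
    (phi : 'I_(2 + 3) -> {mpoly k[n.+1]}) : Prop :=
  forall F : {mpoly k[2 + 3]}, bihomog F ->
    mmap (@mpolyC n.+1 k) phi F = 0 -> vanishes_on Q F.

Definition unirational (k : fieldType) (Q : {mpoly k[2 + 3]}) : Prop :=
  exists (n : nat) (phi : 'I_(2 + 3) -> {mpoly k[n.+1]}),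
    rational_map Q phi /\ dominant Q phi.

Record conic_data (k : fieldType) := ConicData {
  s00 : {mpoly k[2]}; s01 : {mpoly k[2]}; s02 : {mpoly k[2]};
  s11 : {mpoly k[2]}; s12 : {mpoly k[2]}; s22 : {mpoly k[2]};
  s00_homog : s00 \is 6.-homog;
  s01_homog : s01 \is 4.-homog;
  s02_homog : s02 \is 3.-homog;
  s11_homog : s11 \is 2.-homog;
  s12_homog : s12 \is 1.-homog;
  s22_homog : s22 \is 0.-homog
}.

Definition x_form (k : fieldType) (s : {mpoly k[2]}) : {mpoly k[2 + 3]} :=
  s \mPo [tuple 'X_(xv i) | i < 2].

Definition conic_equation (k : fieldType) (s : conic_data k) :
    {mpoly k[2 + 3]} :=
  let y0 := 'X_(yv (@Ordinal 3 0 isT)) in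
  let y1 := 'X_(yv (@Ordinal 3 1 isT)) in
  let y2 := 'X_(yv (@Ordinal 3 2 isT)) in
  x_form (s00 s) * y0 ^+ 2 + x_form (s01 s) * (y0 * y1)
  + x_form (s02 s) * (y0 * y2) + x_form (s11 s) * y1 ^+ 2
  + x_form (s12 s) * (y1 * y2) + x_form (s22 s) * y2 ^+ 2.

(* Coefficients of x_0^(d-l) x_1^l, for l = 0, ..., d, of a binary form. *)
Definition form_coefs (k : fieldType) (d : nat) (s : {mpoly k[2]}) : seq k :=
  [seq s@_[multinom [tuple (d - l)%N; l]] | l <- iota 0 d.+1].

(* The 7 + 5 + 4 + 3 + 2 + 1 = 22 coefficients, i.e. homogeneous coordinates on
   the projective space of tuples up to scaling. *)
Definition conic_coords (k : fieldType) (s : conic_data k) : 'I_22 -> k :=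
  fun t => nth 0 (form_coefs 6 (s00 s) ++ form_coefs 4 (s01 s)
    ++ form_coefs 3 (s02 s) ++ form_coefs 2 (s11 s)
    ++ form_coefs 1 (s12 s) ++ form_coefs 0 (s22 s)) t.

Definition general_conic_bundle (k : fieldType)
    (P : conic_data k -> Prop) : Prop :=
  exists U : ('I_22 -> k) -> Prop,
    [/\ zariski_open U, exists v, U v
      & forall s : conic_data k, U (conic_coords s) -> P s].

(* Main.v *)
Require Import Defs.
From mathcomp Require Import all_boot all_order all_algebra.
From mathcomp Require Import mpoly.
From mathcomp Require Import ring.

(* The curve y_0 = 0 in the conic bundle is a double cover of P^1; completing
   the square with W = 2 s22 y_2 + s02 y_0 + s12 y_1, it becomes the plane conic
   w^2 = d(x) with d = s12^2 - 4 s22 s11 a binary quadratic form. For general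
   coefficients this conic is smooth, and it has a point over a C_1 field, so it
   is a P^1. Over it the conic bundle acquires the section (0 : 1 : w), and
   projecting the fibres from that section gives the unirational
   parametrization.
   Dominance: modulo Q, a Cox polynomial F is E + W O with E, O polynomial in
   (x, y_0, y_1). The points over those x with d(x) a square come in pairs W, -W,
   both in the image; so if F vanishes on the image, E and O vanish on a dense
   set of values (x, y_0, y_1), hence everywhere. *)

Set Implicit Arguments.
Unset Strict Implicit.
Unset Printing Implicit Defensive.

Import GRing.Theory.
Local Open Scope ring_scope.

(** * Evaluation and homogeneity of multivariate polynomials *)

Lemma mmap_comp (k : fieldType) (n m : nat) (R : comNzRingType)
    (f : {rmorphism k -> R}) (v : 'I_m -> R) (phi : 'I_n -> {mpoly k[m]})
    (F : {mpoly k[n]}) :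
  mmap f v (mmap (@mpolyC m k) phi F) = mmap f (fun i => mmap f v (phi i)) F.
Proof.
rewrite [X in mmap f v X]/mmap raddf_sum /=; apply: eq_bigr => a _.
rewrite rmorphM /= mmapC /mmap1 rmorph_prod; congr (_ * _).
by apply: eq_bigr => i _; rewrite rmorphXn.
Qed.

Lemma mmap_x_form (k : fieldType) (R : comNzRingType)
    (f : {rmorphism k -> R}) (v : 'I_(2 + 3) -> R) (s : {mpoly k[2]}) :
  mmap f v (x_form s) = mmap f (v \o xv) s.
Proof.
rewrite mmap_comp; apply: eq_bigr => a _; congr (_ * _).
rewrite /mmap1; apply: eq_bigr => i _.
by rewrite tnth_mktuple mmapX mmap1U.
Qed.

Lemma dhomog_mmap (k : fieldType) (n m : nat) (d e : nat)
    (phi : 'I_n -> {mpoly k[m]}) (F : {mpoly k[n]}) :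
  F \is d.-homog -> (forall i, phi i \is e.-homog) ->
  mmap (@mpolyC m k) phi F \is (e * d)%N.-homog.
Proof.
move=> /dhomogP Fd phi_e; rewrite /mmap big_seq; apply: rpred_sum => a /Fd <-.
rewrite mul_mpolyC; apply: rpredZ; rewrite /= mdegE big_distrr /mmap1 /=.
apply: (big_ind2 (fun (p : {mpoly k[m]}) c => p \is c.-homog)) => [|p1 c1 p2 c2|i _].
- exact: dhomog1.
- exact: dhomogM.
- exact/dhomogMn/phi_e.
Qed.

(** A monomial of degree d in two variables is determined by its exponent in x_1, so indexing by
    that exponent covers the whole support. *)
Lemma mmap_binary_form (k : fieldType) (R : comNzRingType)
    (f : {rmorphism k -> R}) (x : 'I_2 -> R) (d : nat) (s : {mpoly k[2]}) :
  s \is d.-homog ->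
  mmap f x s = \sum_(l < d.+1)
    f (nth 0 (form_coefs d s) l) * (x 0 ^+ (d - l) * x 1 ^+ l).
Proof.
move=> sd; pose M l := [multinom [tuple (d - l)%N; l]].
have sE : s = \sum_(l < d.+1) s@_(M l) *: 'X_[M l].
  apply/mpolyP => m; rewrite raddf_sum /=.
  under eq_bigr => l _ do rewrite mcoeffZ mcoeffX.
  case: (boolP (mdeg m == d)) => [/eqP md|md]; last first.
    rewrite (dhomog_nemf_coeff sd md) big1 // => l _.
    case: eqP => [Em|]; last by rewrite mulr0.
    case/eqP: md; rewrite -Em mdegE !big_ord_recl big_ord0 /= addn0.
    by rewrite /M !multinomE /= subnK // -ltnS.
  have md2 : (m ord0 + m (lift ord0 ord0) = d)%N.
    by rewrite -md mdegE !big_ord_recl big_ord0 addn0.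
  have l_lt : (m (lift ord0 ord0) < d.+1)%N by rewrite ltnS -md2 leq_addl.
  have MP (l : 'I_d.+1) : (M l == m) = (l == Ordinal l_lt).
    apply/eqP/eqP => [Ml|->]; first by apply: val_inj; rewrite /= -Ml multinomE.
    apply/mnmP => i; rewrite multinomE; case: i => [[|[|//]] lti]; rewrite /tnth /=.
      by rewrite -{1}md2 addnK; congr (m _); apply: val_inj.
    by congr (m _); apply: val_inj.
  rewrite (bigD1 (Ordinal l_lt)) //= -/(M _) (MP (Ordinal l_lt)) eqxx mulr1.
  rewrite big1 ?addr0 => [|l ne].
    by congr (_@__); apply/esym/eqP; rewrite (MP (Ordinal l_lt)).
  by rewrite MP (negPf ne) mulr0.
rewrite {1}sE raddf_sum /=; apply: eq_bigr => l _.
rewrite mmapZ mmapX (nth_map 0%N) ?size_iota // nth_iota // add0n; congr (_ * _).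
rewrite /mmap1 !big_ord_recl big_ord0 mulr1 !multinomE /tnth /=.
by congr (x _ ^+ _ * x _ ^+ _); apply: val_inj.
Qed.

Lemma eq_mmap (k : fieldType) (n : nat) (R : comNzRingType)
    (f : {rmorphism k -> R}) (u v : 'I_n -> R) : u =1 v -> mmap f u =1 mmap f v.
Proof. by move=> uv F; apply: eq_bigr => m _; rewrite (mmap1_eq _ uv). Qed.

Lemma mmap_neq0 (k : fieldType) (n : nat) (R : comNzRingType)
    (f : {rmorphism k -> R}) (v : 'I_n -> R) (p : {mpoly k[n]}) : mmap f v p != 0 -> p != 0.
Proof. by apply: contra => /eqP->; rewrite rmorph0. Qed.

Lemma homogM (k : fieldType) (n d e c : nat) (p q : {mpoly k[n]}) :
  p \is d.-homog -> q \is e.-homog -> (d + e)%N = c -> p * q \is c.-homog.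
Proof. by move=> pd qe <-; apply: dhomogM. Qed.

Lemma homogC (k : fieldType) (n d : nat) (c : k) (p : {mpoly k[n]}) :
  p \is d.-homog -> c%:MP * p \is d.-homog.
Proof. by move=> pd; rewrite mul_mpolyC rpredZ. Qed.

Lemma homogX (k : fieldType) (n : nat) (i : 'I_n) : ('X_i : {mpoly k[n]}) \is 1.-homog.
Proof. by rewrite dhomogX /= mdeg1. Qed.

Lemma homogXn (k : fieldType) (n e : nat) (i : 'I_n) : ('X_i ^+ e : {mpoly k[n]}) \is e.-homog.
Proof. by rewrite -[X in X.-homog]mul1n dhomogMn ?homogX. Qed.

Lemma homog_scale0 (k : fieldType) (i n d : nat) (c p : {mpoly k[i]}) :
  c \is 0.-homog -> p \is d.-homog -> n%:R * c * p \is d.-homog.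
Proof.
move=> c0 pd; rewrite -mulrA mulr_natl rpredMn //.
exact: (dhomogM c0 pd).
Qed.

(** * Density and polynomial functions *)

(** On an affine line an infinite set is Zariski dense; nesting this predicate expresses density in
    several variables. *)
Definition infinitely_many (T : eqType) (P : T -> Prop) : Prop :=
  forall s : seq T, exists2 x, P x & x \notin s.

Lemma infinitely_many_mono (T : eqType) (P Q : T -> Prop) :
  (forall x, P x -> Q x) -> infinitely_many P -> infinitely_many Q.
Proof. by move=> PQ infP s; have [x /PQ] := infP s; exists x. Qed.

Lemma infinitely_many_uniq (T : eqType) (P : T -> Prop) (n : nat) :
  infinitely_many P ->
  exists s : seq T, [/\ uniq s, size s = n & forall x, x \in s -> P x].
Proof.
move=> infP; elim: n => [|n [s [us ss Ps]]]; first by exists [::].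
have [x Px xs] := infP s; exists (x :: s); split=> [/=||y]; rewrite /= ?xs ?ss //.
by rewrite inE => /orP[/eqP->|/Ps].
Qed.

(** Field morphisms are injective, so [(size s).+1] distinct elements of k cannot all map into [s].
    Dominance is tested at points over arbitrary extensions, where infinitude is needed again. *)
Lemma infinite_field_extension (k L : fieldType) (iota : {rmorphism k -> L}) :
  infinite_field k -> infinite_field L.
Proof.
move=> infk s.
have [|t [ut st _]] := @infinitely_many_uniq k (fun _ => True) (size s).+1.
  by move=> r; have [x] := infk r; exists x.
have [/hasP[_ /mapP[x _ ->] xs]|/hasPn sub] :=
  boolP (has [predC s] (map iota t)); first by exists (iota x).
have uit : uniq (map iota t) by rewrite map_inj_uniq //; apply: fmorph_inj.
have : (size (map iota t) <= size s)%N.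
  by apply: uniq_leq_size uit _ => x /sub; rewrite /= negbK.
by rewrite size_map st ltnn.
Qed.

Lemma poly_infinitely_many_roots (L : fieldType) (p : {poly L}) :
  infinitely_many (fun x => p.[x] = 0) -> p = 0.
Proof.
move=> infp; apply/eqP/negPn/negP => p0.
have [s [us ss rs]] := infinitely_many_uniq (size p) infp.
have : all (root p) s by apply/allP => x /rs/eqP.
by move=> /(max_poly_roots p0)/(_ us); rewrite ss ltnn.
Qed.

Lemma poly_nonroot (L : fieldType) (p : {poly L}) :
  infinite_field L -> p != 0 -> exists x, p.[x] != 0.
Proof.
move=> infL p0.
have [|s [us ss _]] := @infinitely_many_uniq L (fun _ => True) (size p).
  by move=> s; have [x] := infL s; exists x.
have [/allP rs|/allPn[x _ px]] := boolP (all (root p) s); last by exists x.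
by have := max_poly_roots p0 (introT allP rs) us; rewrite ss ltnn.
Qed.

(** The last hypothesis says that f / g is not constant. If its values off the zeros of g q all lay
    in [s], the nonzero polynomial g q times the product of the f - c g over [s] would vanish
    everywhere. *)
Lemma infinitely_many_ratios (L : fieldType) (f g q : {poly L}) :
  infinite_field L -> g != 0 -> q != 0 -> (forall c, f - c *: g != 0) ->
  infinitely_many (fun c => exists r, [/\ g.[r] != 0, q.[r] != 0 & c = f.[r] / g.[r]]).
Proof.
move=> infL g0 q0 fg s.
have p0 : g * q * \prod_(c <- s) (f - c *: g) != 0.
  by rewrite !mulf_neq0 // prodf_seq_neq0; apply/allP => c _; apply: fg.
have [r] := poly_nonroot infL p0.
rewrite !hornerM !mulf_eq0 !negb_or => /andP[/andP[gr qr] pr].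
exists (f.[r] / g.[r]); first by exists r.
apply: contra pr => rs; rewrite horner_prod prodf_seq_eq0; apply/hasP.
exists (f.[r] / g.[r]) => //=.
by rewrite !hornerE divfK // subrr.
Qed.

(** Invariance under pointwise equality stands in for functional extensionality. *)
Definition subalgebra (T : Type) (L : fieldType) (C : (T -> L) -> Prop) : Prop :=
  [/\ forall f g, f =1 g -> C f -> C g,
      forall c, C (fun _ => c),
      forall f g, C f -> C g -> C (fun v => f v + g v)
    & forall f g, C f -> C g -> C (fun v => f v * g v)].

Lemma subalgebra_mmap (T : Type) (k L : fieldType) (iota : {rmorphism k -> L})
    (C : (T -> L) -> Prop) (n : nat) (h : T -> 'I_n -> L) (F : {mpoly k[n]}) :
  subalgebra C -> (forall i, C (h^~ i)) -> C (fun v => mmap iota (h v) F).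
Proof.
move=> [Cext Cc CD CM] Ch; rewrite /mmap.
have CX f j : C f -> C (fun v => f v ^+ j).
  move=> Cf; elim: j => [|j IH]; first exact: Cc.
  by apply: Cext (CM _ _ Cf IH) => v; rewrite exprS.
elim: (msupp F) => [|m s IH].
  by apply: Cext (Cc 0) => v; rewrite big_nil.
apply: (Cext) (CD _ _ _ IH); first by move=> v; rewrite big_cons.
apply: (CM); first exact: Cc.
rewrite /mmap1; elim: (index_enum _) => [|i r IHr].
  by apply: Cext (Cc 1) => v; rewrite big_nil.
by apply: Cext (CM _ _ (CX _ (m i) (Ch i)) IHr) => v; rewrite big_cons.
Qed.

Definition polyfun (L : fieldType) (f : L -> L) : Prop :=
  exists p : {poly L}, f =1 horner p.

Lemma polyfun_subalgebra (L : fieldType) : subalgebra (@polyfun L).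
Proof.
split=> [f g fg [p pf]|c|f g [p pf] [q qg]|f g [p pf] [q qg]].
- by exists p => x; rewrite -fg.
- by exists c%:P => x; rewrite hornerC.
- by exists (p + q) => x; rewrite hornerD pf qg.
- by exists (p * q) => x; rewrite hornerM pf qg.
Qed.

Lemma polyfun_id (L : fieldType) : polyfun (@id L).
Proof. by exists 'X => x; rewrite hornerX. Qed.

Lemma polyfun_eq0 (L : fieldType) (f : L -> L) :
  polyfun f -> infinitely_many (fun x => f x = 0) -> forall x, f x = 0.
Proof.
move=> [p pf] inff x; rewrite pf (_ : p = 0) ?horner0 //.
by apply: poly_infinitely_many_roots; apply: infinitely_many_mono inff => y; rewrite pf.
Qed.

(** Polynomiality in each variable separately is enough for a vanishing argument that treats one
    variable at a time. *)
Definition polyfun4 (L : fieldType) (E : L * L * L * L -> L) : Prop :=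
  forall a b c d, [/\ polyfun (fun t => E (t, b, c, d)), polyfun (fun t => E (a, t, c, d)),
                      polyfun (fun t => E (a, b, t, d)) & polyfun (fun t => E (a, b, c, t))].

Lemma polyfun4_subalgebra (L : fieldType) : subalgebra (@polyfun4 L).
Proof.
have [Pext Pc PD PM] := polyfun_subalgebra L.
split=> [f g fg Pf|c|f g Pf Pg|f g Pf Pg] a1 a2 a3 a4.
- by case: (Pf a1 a2 a3 a4) => H1 H2 H3 H4; split; [move: H1|move: H2|move: H3|move: H4];
    apply: Pext => t; apply: fg.
- by split; apply: Pc.
- by case: (Pf a1 a2 a3 a4) (Pg a1 a2 a3 a4) => ? ? ? ? [? ? ? ?]; split; apply: PD.
- by case: (Pf a1 a2 a3 a4) (Pg a1 a2 a3 a4) => ? ? ? ? [? ? ? ?]; split; apply: PM.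
Qed.

(** For each of the infinitely many good a, the same argument in fewer variables gives vanishing for
    all b, c, d; then the polynomial in a has infinitely many roots. *)
Lemma polyfun4_eq0 (L : fieldType) (E : L * L * L * L -> L) :
  polyfun4 E ->
  infinitely_many (fun a => infinitely_many (fun b =>
    infinitely_many (fun c => infinitely_many (fun d => E (a, b, c, d) = 0)))) ->
  forall v, E v = 0.
Proof.
move=> PE infE [[[a b] c] d]; move: a.
apply: polyfun_eq0; first by have [] := PE 0 b c d.
apply: infinitely_many_mono infE => a infE; move: b.
apply: polyfun_eq0; first by have [] := PE a 0 c d.
apply: infinitely_many_mono infE => b infE; move: c.
apply: polyfun_eq0; first by have [] := PE a b 0 d.
apply: infinitely_many_mono infE => c infE; move: d.
by apply: polyfun_eq0 infE; have [] := PE a b c 0.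
Qed.

(** Functions on the double cover W^2 = D lying in the module generated by 1 and W over polynomial
    functions on the base; the decomposition is required only on the cover. *)
Definition splits_on (L : fieldType) (D : L * L * L * L -> L)
    (f : L * L * L * L * L -> L) : Prop :=
  exists E O, [/\ polyfun4 E, polyfun4 O
    & forall v W, W ^+ 2 = D v -> f (v, W) = E v + W * O v].

(** Closure under products comes from W^2 O1 O2 = D O1 O2, which moves this term into the part
    without W. *)
Lemma splits_on_subalgebra (L : fieldType) (D : L * L * L * L -> L) :
  polyfun4 D ->
  [/\ forall E, polyfun4 E -> splits_on D (fun u => E u.1),
      splits_on D snd & subalgebra (splits_on D)].
Proof.
move=> PD; have [Pext Pc PA PM] := polyfun4_subalgebra L.
have sE E : polyfun4 E -> splits_on D (fun u => E u.1).
  by exists E, (fun=> 0); split=> // v W _; rewrite mulr0 addr0.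
split=> //.
  by exists (fun=> 0), (fun=> 1); split=> // v W _; rewrite mulr1 add0r.
split=> [f g fg|c|f g|f g].
- by move=> [E [O [? ? fE]]]; exists E, O; split=> // v W DW; rewrite -fg fE.
- exact: (sE (fun=> c)).
- move=> [E1 [O1 [? ? fE]]] [E2 [O2 [? ? gE]]].
  exists (fun v => E1 v + E2 v), (fun v => O1 v + O2 v); split; try exact: PA.
  by move=> v W DW; rewrite fE ?gE //; ring.
- move=> [E1 [O1 [? ? fE]]] [E2 [O2 [? ? gE]]].
  exists (fun v => E1 v * E2 v + D v * (O1 v * O2 v)), (fun v => E1 v * O2 v + O1 v * E2 v).
  split; first by apply: PA; [apply: PM | apply: (PM) => //; apply: PM].
    by apply: PA; apply: PM.
  by move=> v W DW; rewrite fE ?gE // -DW; ring.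
Qed.

Definition quad (L : fieldType) (c0 c1 c2 : L) : {poly L} := c0%:P + c1 *: 'X + c2 *: 'X^2.

Lemma quad_horner (L : fieldType) (c0 c1 c2 r : L) :
  (quad c0 c1 c2).[r] = c0 + c1 * r + c2 * r ^+ 2.
Proof. by rewrite /quad !hornerE. Qed.

Lemma quad_neq0 (L : fieldType) (c0 c1 c2 : L) :
  (c1 != 0) || (c2 != 0) -> quad c0 c1 c2 != 0.
Proof.
apply: contraTneq => q0.
have := congr1 (fun p : {poly L} => p`_1) q0.
have := congr1 (fun p : {poly L} => p`_2) q0.
by rewrite /quad !coefE /= !mulr0 !mulr1 !add0r !addr0 => -> ->; rewrite eqxx.
Qed.

Lemma quad_sub (L : fieldType) (c0 c1 c2 e0 e1 e2 c : L) :
  quad c0 c1 c2 - c *: quad e0 e1 e2 = quad (c0 - c * e0) (c1 - c * e1) (c2 - c * e2).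
Proof. by rewrite /quad -!mul_polyC !rmorphB !rmorphM /=; ring. Qed.

(** * Conics and completing the square *)

Local Notation y0v := (yv (@Ordinal 3 0 isT)).
Local Notation y1v := (yv (@Ordinal 3 1 isT)).
Local Notation y2v := (yv (@Ordinal 3 2 isT)).

Lemma mmap_conic (k : fieldType) (R : comNzRingType)
    (f : {rmorphism k -> R}) (v : 'I_(2 + 3) -> R) (s : conic_data k) :
  let S := mmap f (v \o xv) in
  mmap f v (conic_equation s) =
    S (s00 s) * v y0v ^+ 2 + S (s01 s) * (v y0v * v y1v) + S (s02 s) * (v y0v * v y2v)
    + S (s11 s) * v y1v ^+ 2 + S (s12 s) * (v y1v * v y2v) + S (s22 s) * v y2v ^+ 2.
Proof.
by move=> S; rewrite !(rmorphD, rmorphM, rmorphXn) /= !mmapX !mmap1U !mmap_x_form.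
Qed.

(** The C_1 property in degree 2 and three variables gives a nontrivial zero (a, c) of d(a) - c^2.
    If c is nonzero, divide by it; otherwise d is isotropic with nonzero discriminant, and so still
    takes the value 1. *)
Lemma C1_represents_one (k : fieldType) (d0 d1 d2 : k) :
  C1_field k -> d1 ^+ 2 - 4%:R * d0 * d2 != 0 ->
  exists a0 a1, d0 * a0 ^+ 2 + d1 * (a0 * a1) + d2 * a1 ^+ 2 = 1.
Proof.
move=> C1 disc.
pose p : {mpoly k[3]} :=
  d0 *: 'X_(@Ordinal 3 0 isT) ^+ 2 + d1 *: ('X_(@Ordinal 3 0 isT) * 'X_(@Ordinal 3 1 isT))
  + d2 *: 'X_(@Ordinal 3 1 isT) ^+ 2 - 'X_(@Ordinal 3 2 isT) ^+ 2.
have phom : p \is 2.-homog.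
  by rewrite rpredB ?rpredD ?rpredZ ?homogXn //; apply: (dhomogM (homogX _ _) (homogX _ _)).
have [v [[i vi] pv]] := C1 3 2 p isT phom.
set a0 := v (@Ordinal 3 0 isT); set a1 := v (@Ordinal 3 1 isT).
set c := v (@Ordinal 3 2 isT).
have ac : d0 * a0 ^+ 2 + d1 * (a0 * a1) + d2 * a1 ^+ 2 = c ^+ 2.
  apply/eqP; rewrite -subr_eq0; apply/eqP; rewrite -pv.
  by rewrite !(mevalB, mevalD, mevalZ, mevalM, rmorphXn) /= !mevalXU.
have [c0|c0] := eqVneq c 0; last first.
  exists (a0 / c), (a1 / c).
  transitivity ((d0 * a0 ^+ 2 + d1 * (a0 * a1) + d2 * a1 ^+ 2) / c ^+ 2); first by field.
  by rewrite ac divff ?expf_neq0.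
have a_neq0 : (a0 != 0) || (a1 != 0).
  apply: contraT; rewrite negb_or !negbK => /andP[/eqP a00 /eqP a10].
  case/eqP: vi; rewrite (_ : i = @Ordinal 3 i (ltn_ord i)); last exact: val_inj.
  case: i => [[|[|[|//]]] lti];
    [rewrite -a00|rewrite -a10|rewrite -c0]; congr v; exact: val_inj.
move: ac; rewrite c0 expr0n /= => ac.
(* The form is isotropic at [a]; its gradient there is nonzero, so it takes the
   value 1 on an affine line parallel to [a]. *)
set g0 := 2%:R * d0 * a0 + d1 * a1; set g1 := d1 * a0 + 2%:R * d2 * a1.
have [g00|g00] := eqVneq g0 0; last first.
  (* On the line t a + (1, 0) the form equals t g0 + d0, which is 1 at t = (1 - d0) / g0. The next
     case uses (0, 1) instead. *)
  exists ((1 - d0) / g0 * a0 + 1), ((1 - d0) / g0 * a1).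
  set t := (1 - d0) / g0.
  have tg : t * g0 = 1 - d0 by rewrite /t divfK.
  transitivity (t ^+ 2 * (d0 * a0 ^+ 2 + d1 * (a0 * a1) + d2 * a1 ^+ 2) + t * g0 + d0).
    by rewrite /g0; ring.
  by rewrite ac tg; ring.
have [g10|g10] := eqVneq g1 0; last first.
  exists ((1 - d2) / g1 * a0), ((1 - d2) / g1 * a1 + 1).
  set t := (1 - d2) / g1.
  have tg : t * g1 = 1 - d2 by rewrite /t divfK.
  transitivity (t ^+ 2 * (d0 * a0 ^+ 2 + d1 * (a0 * a1) + d2 * a1 ^+ 2) + t * g1 + d2).
    by rewrite /g1; ring.
  by rewrite ac tg; ring.
(* Both partial derivatives now vanish at a; by Cramer's rule the discriminant times a is 0,
   contradicting a nonzero. *)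
have : (d1 ^+ 2 - 4%:R * d0 * d2) * a0 = d1 * g1 - 2%:R * d2 * g0.
  by rewrite /g0 /g1; ring.
have : (d1 ^+ 2 - 4%:R * d0 * d2) * a1 = d1 * g0 - 2%:R * d0 * g1.
  by rewrite /g0 /g1; ring.
rewrite g00 g10 !mulr0 subrr => /eqP + /eqP.
by rewrite !mulf_eq0 (negPf disc) /= => a10 a00; move: a_neq0; rewrite a00 a10.
Qed.

(** * The conic bundle as a double cover *)

Section Bundle.

Variables (k : fieldType) (s : conic_data k).

(** With W = 2 s22 y_2 + s02 y_0 + s12 y_1, the equation Q satisfies 4 s22 Q = W^2 - (a y_0^2 + 2 b
    y_0 y_1 + d y_1^2). *)
Definition form_a : {mpoly k[2]} := s02 s ^+ 2 - 4%:R * s22 s * s00 s.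
Definition form_b : {mpoly k[2]} := s02 s * s12 s - 2%:R * s22 s * s01 s.
Definition form_d : {mpoly k[2]} := s12 s ^+ 2 - 4%:R * s22 s * s11 s.

Lemma form_a_homog : form_a \is 6.-homog.
Proof.
apply: rpredB; last by apply: homog_scale0; [apply: s22_homog|apply: s00_homog].
exact: (dhomogMn 2 (s02_homog s)).
Qed.

Lemma form_b_homog : form_b \is 4.-homog.
Proof.
apply: rpredB; last by apply: homog_scale0; [apply: s22_homog|apply: s01_homog].
exact: (dhomogM (s02_homog s) (s12_homog s)).
Qed.

Definition c22 : k := (s22 s)@_0.

Lemma s22E : s22 s = c22%:MP.
Proof.
apply/mpolyP => m; rewrite mcoeffC; case: eqVneq => [->|m0]; first by rewrite mulr1.
rewrite mulr0; apply: (dhomog_nemf_coeff (s22_homog s)).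
by rewrite /= mdeg_eq0.
Qed.

Definition double_cover (R : comNzRingType) (f : {rmorphism k -> R})
    (x : 'I_2 -> R) (y0 y1 : R) : R :=
  mmap f x form_a * y0 ^+ 2 + 2%:R * mmap f x form_b * (y0 * y1) + mmap f x form_d * y1 ^+ 2.

(** The last coordinate solves the definition of W for y_2. As [R] ranges over rings, one formula
    serves both the polynomial map and its values; the inverse is therefore taken in k. *)
Definition bundle_point (R : comNzRingType) (f : {rmorphism k -> R})
    (x : 'I_2 -> R) (y0 y1 W : R) (i : 'I_(2 + 3)) : R :=
  match split i with
  | inl i => x i
  | inr j => nth 0 [:: y0; y1; f (2%:R * c22)^-1 *
                       (W - mmap f x (s02 s) * y0 - mmap f x (s12 s) * y1)] j
  end.

Lemma bundle_point_xv (R : comNzRingType) (f : {rmorphism k -> R}) x y0 y1 W i :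
  bundle_point f x y0 y1 W (xv i) = x i.
Proof. by rewrite /bundle_point (unsplitK (inl i)). Qed.

Lemma bundle_point_yv (R : comNzRingType) (f : {rmorphism k -> R}) x y0 y1 W j :
  bundle_point f x y0 y1 W (yv j) = nth 0 [:: y0; y1; f (2%:R * c22)^-1 *
                       (W - mmap f x (s02 s) * y0 - mmap f x (s12 s) * y1)] j.
Proof. by rewrite /bundle_point (unsplitK (inr j)). Qed.

Hypothesis two_c22 : 2%:R * c22 != 0.

Lemma mmap_form_a (R : comNzRingType) (f : {rmorphism k -> R}) x :
  mmap f x form_a = mmap f x (s02 s) ^+ 2 - 4%:R * f c22 * mmap f x (s00 s).
Proof. by rewrite !(rmorphB, rmorphM, rmorphXn, rmorph_nat) /= s22E mmapC. Qed.

Lemma mmap_form_b (R : comNzRingType) (f : {rmorphism k -> R}) x :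
  mmap f x form_b =
  mmap f x (s02 s) * mmap f x (s12 s) - 2%:R * f c22 * mmap f x (s01 s).
Proof. by rewrite !(rmorphB, rmorphM, rmorph_nat) /= s22E mmapC. Qed.

Lemma mmap_form_d (R : comNzRingType) (f : {rmorphism k -> R}) x :
  mmap f x form_d = mmap f x (s12 s) ^+ 2 - 4%:R * f c22 * mmap f x (s11 s).
Proof. by rewrite !(rmorphB, rmorphM, rmorphXn, rmorph_nat) /= s22E mmapC. Qed.

Lemma conic_complete_square (R : comNzRingType) (f : {rmorphism k -> R})
    (v : 'I_(2 + 3) -> R) :
  let x := v \o xv in
  4%:R * f c22 * mmap f v (conic_equation s) =
  (2%:R * f c22 * v y2v + mmap f x (s02 s) * v y0v + mmap f x (s12 s) * v y1v) ^+ 2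
  - double_cover f x (v y0v) (v y1v).
Proof.
move=> x; rewrite mmap_conic -/x /double_cover mmap_form_a mmap_form_b mmap_form_d.
by rewrite s22E mmapC; ring.
Qed.

Lemma rmorph_two_c22 (R : comNzRingType) (f : {rmorphism k -> R}) :
  2%:R * f c22 * f (2%:R * c22)^-1 = 1.
Proof.
by rewrite -[2%:R](rmorph_nat f) -!rmorphM mulfV // rmorph1.
Qed.

Lemma bundle_point_on_conic (R : comNzRingType) (f : {rmorphism k -> R}) x y0 y1 W :
  W ^+ 2 = double_cover f x y0 y1 ->
  mmap f (bundle_point f x y0 y1 W) (conic_equation s) = 0.
Proof.
move=> WD; set v := bundle_point _ _ _ _ _.
have vy j := bundle_point_yv f x y0 y1 W j; rewrite -/v in vy.
have xE : v \o xv =1 x by move=> i; apply: bundle_point_xv.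
have := conic_complete_square f v.
rewrite /double_cover !(eq_mmap f xE) -/(double_cover f x _ _).
rewrite !vy /= mulrA rmorph_two_c22 mul1r.
rewrite (_ : W - _ - _ + _ + _ = W); last by ring.
(* In a mere ring, 4 c22 is cancelled by multiplying with (2 c22)^-2 c22. *)
rewrite WD subrr => /(congr1 (fun z => f (2%:R * c22)^-1 ^+ 2 * (f c22 * z))).
rewrite !mulr0 => E0.
rewrite -E0.
transitivity (mmap f v (conic_equation s) * (2%:R * f c22 * f (2%:R * c22)^-1) ^+ 2).
  by rewrite rmorph_two_c22 expr1n mulr1.
by ring.
Qed.

Lemma on_conic_bundle_point (R : comNzRingType) (f : {rmorphism k -> R}) v :
  mmap f v (conic_equation s) = 0 ->
  exists W, W ^+ 2 = double_cover f (v \o xv) (v y0v) (v y1v) /\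
    v =1 bundle_point f (v \o xv) (v y0v) (v y1v) W.
Proof.
move=> Qv; have := conic_complete_square f v; rewrite Qv mulr0.
move/esym/eqP; rewrite subr_eq0 => /eqP WD.
eexists; split; first exact: WD.
move=> i; rewrite /bundle_point -{1}(splitK i); case: (split i) => [//|j] /=.
rewrite -/(yv j); case: j => [[|[|[|//]]] lt]; rewrite /=.
- by congr (v (yv _)); apply: val_inj.
- by congr (v (yv _)); apply: val_inj.
rewrite (_ : yv _ = y2v); last by congr yv; apply: val_inj.
transitivity (2%:R * f c22 * f (2%:R * c22)^-1 * v y2v); last by ring.
by rewrite rmorph_two_c22 mul1r.
Qed.
End Bundle.

(** * The unirational parametrization *)

Section Param.

Variables (k : fieldType) (s : conic_data k).
Hypothesis two_c22 : 2%:R * c22 s != 0.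
Hypothesis two_neq0 : 2%:R != 0 :> k.
Variables (a b : 'I_2 -> k) (gam : k).

(** Coordinates X, Y in the basis a, b of k^2, which diagonalizes d: by [form_dE], d(a) = 1, d(b) =
    gam, and there is no cross term. *)
Definition base_point (R : comNzRingType) (f : {rmorphism k -> R}) (X Y : R) (i : 'I_2) : R :=
  X * f (a i) + Y * f (b i).

Hypothesis ab_det : a 0 * b 1 - a 1 * b 0 = 2%:R.
Hypothesis gam_neq0 : gam != 0.
Hypothesis form_dE : forall (R : comNzRingType) (f : {rmorphism k -> R}) X Y,
  mmap f (base_point f X Y) (form_d s) = X ^+ 2 + f gam * Y ^+ 2.

(* The conic W^2 = a y_0^2 + 2 b y_0 y_1 + w^2 y_1^2 passes through (0 : 1 : w);
   this is its other intersection with the line W - w y_1 = m y_0. *)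
Definition fiber_point (R : comNzRingType) (f : {rmorphism k -> R})
    (x : 'I_2 -> R) (w m rho : R) : 'I_(2 + 3) -> R :=
  let y0 := rho * (w * m - mmap f x (form_b s)) *+ 2 in
  let y1 := rho * (mmap f x (form_a s) - m ^+ 2) in
  bundle_point s f x y0 y1 (w * y1 + m * y0).

(** Substituting W = w y_1 + m y_0 and w^2 = d leaves y_0 times (m^2 - a) y_0 + 2 (w m - b) y_1; the
    chosen y_0, y_1 annihilate the second factor. *)
Lemma fiber_point_on_conic (R : comNzRingType) (f : {rmorphism k -> R})
    (x : 'I_2 -> R) (w m rho : R) :
  w ^+ 2 = mmap f x (form_d s) ->
  mmap f (fiber_point f x w m rho) (conic_equation s) = 0.
Proof. by move=> wd; apply: bundle_point_on_conic => //; rewrite /double_cover -wd; ring. Qed.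

Lemma mmap_bundle_point (n : nat) (R : comNzRingType) (f : {rmorphism k -> R})
    (v : 'I_n -> R) (x : 'I_2 -> {mpoly k[n]}) y0 y1 W :
  let g := mmap f v in
  g \o bundle_point s (@mpolyC n k) x y0 y1 W
  =1 bundle_point s f (g \o x) (g y0) (g y1) (g W).
Proof.
move=> g i; rewrite /bundle_point /=; case: (split i) => [//|[[|[|[|//]]] lt]] //=.
by rewrite /g !(rmorphM, rmorphB) /= mmapC !mmap_comp.
Qed.

(** Naturality in the ring: the values of the polynomial map are again given by [fiber_point]. *)
Lemma mmap_fiber_point (n : nat) (R : comNzRingType) (f : {rmorphism k -> R})
    (v : 'I_n -> R) (x : 'I_2 -> {mpoly k[n]}) w m rho :
  let g := mmap f v in
  g \o fiber_point (@mpolyC n k) x w m rho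
  =1 fiber_point f (g \o x) (g w) (g m) (g rho).
Proof.
move=> g i; rewrite /fiber_point [LHS]mmap_bundle_point -/g.
have gW p q : g (w * p + m * q) = g w * g p + g m * g q by rewrite /g rmorphD !rmorphM.
have gy0 : g (rho * (w * m - mmap (@mpolyC n k) x (form_b s)) *+ 2) =
    g rho * (g w * g m - mmap f (g \o x) (form_b s)) *+ 2.
  by rewrite /g rmorphMn rmorphM rmorphB rmorphM /= mmap_comp.
have gy1 : g (rho * (mmap (@mpolyC n k) x (form_a s) - m ^+ 2)) =
    g rho * (mmap f (g \o x) (form_a s) - g m ^+ 2).
  by rewrite /g rmorphM rmorphB rmorphXn /= mmap_comp.
by rewrite gW gy0 gy1.
Qed.

Lemma eq_fiber_point (R : comNzRingType) (f : {rmorphism k -> R})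
    (x x' : 'I_2 -> R) (w m rho : R) :
  x =1 x' -> fiber_point f x w m rho =1 fiber_point f x' w m rho.
Proof.
move=> xx i; rewrite /fiber_point /bundle_point !(eq_mmap f xx).
by case: (split i) => [j|//]; apply: xx.
Qed.

(* Parametrization of X^2 + gam Y^2 = w^2, the equation w^2 = d(x) in the
   coordinates X, Y of [base_point]. *)
Definition unirational_base : 'I_2 -> {mpoly k[6]} :=
  let sg := 'X_(@Ordinal 6 0 isT) in let tau := 'X_(@Ordinal 6 1 isT) in
  let lam := 'X_(@Ordinal 6 2 isT) in
  base_point (@mpolyC 6 k) (lam * (tau ^+ 2 - gam%:MP * sg ^+ 2)) (lam * (tau * sg) *+ 2).

(** The matching w, since (tau^2 + gam sg^2)^2 = (tau^2 - gam sg^2)^2 + gam (2 tau sg)^2. The factor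
    lam makes the vector (X, Y, w) adjustable, not only its class up to scaling. *)
Definition unirational_sqrt : {mpoly k[6]} :=
  let sg := 'X_(@Ordinal 6 0 isT) in let tau := 'X_(@Ordinal 6 1 isT) in
  let lam := 'X_(@Ordinal 6 2 isT) in
  lam * (tau ^+ 2 + gam%:MP * sg ^+ 2).

(* The slope has to be homogeneous of three times the degree of x_0, x_1; the
   variable z serves only to achieve this. *)
Definition unirational_map : 'I_(2 + 3) -> {mpoly k[6]} :=
  let rho := 'X_(@Ordinal 6 3 isT) in
  let t := 'X_(@Ordinal 6 4 isT) in let z := 'X_(@Ordinal 6 5 isT) in
  fiber_point (@mpolyC 6 k) unirational_base unirational_sqrt (t * z ^+ 8) rho.

(** Setting z = 1 turns the parameter t into the slope m. *)
Definition parameters (R : comNzRingType) (sg tau lam rho m : R) (i : 'I_6) : R :=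
  nth 0 [:: sg; tau; lam; rho; m; 1] i.

Lemma mmap_unirational_map (R : comNzRingType) (f : {rmorphism k -> R})
    (sg tau lam rho m : R) :
  mmap f (parameters sg tau lam rho m) \o unirational_map =1
  fiber_point f
    (base_point f (lam * (tau ^+ 2 - f gam * sg ^+ 2)) (lam * (tau * sg) *+ 2))
    (lam * (tau ^+ 2 + f gam * sg ^+ 2)) m rho.
Proof.
move=> i; rewrite [LHS]mmap_fiber_point.
have ->: mmap f (parameters sg tau lam rho m) unirational_sqrt =
    lam * (tau ^+ 2 + f gam * sg ^+ 2).
  rewrite /unirational_sqrt !(rmorphM, rmorphD, rmorphXn) /=.
  by rewrite mmapC !mmapX !mmap1U.
have -> : mmap f (parameters sg tau lam rho m)
    ('X_(@Ordinal 6 4 isT) * 'X_(@Ordinal 6 5 isT) ^+ 8) = m.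
  by rewrite rmorphM rmorphXn /= !mmapX !mmap1U /parameters /= expr1n mulr1.
rewrite mmapX mmap1U /=; apply: eq_fiber_point => j /=.
rewrite /unirational_base /base_point.
rewrite !(rmorphD, rmorphM, rmorphMn, rmorphN, rmorphXn) /=.
by rewrite !mmapC !mmapX !mmap1U.
Qed.

Lemma unirational_map_on_conic : mmap (@mpolyC 6 k) unirational_map (conic_equation s) = 0.
Proof.
apply: fiber_point_on_conic; rewrite form_dE /unirational_sqrt /=; ring.
Qed.

Lemma unirational_base_homog i : unirational_base i \is 3.-homog.
Proof.
rewrite /unirational_base /base_point rpredD //= mulrC; apply: homogC.
  apply: (homogM (d := 1) (e := 2)) => //; first exact: homogX.
  rewrite rpredB //; first exact: homogXn.
  exact/homogC/homogXn.
rewrite rpredMn //; apply: (homogM (d := 1) (e := 2)) => //; first exact: homogX.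
by apply: (homogM (d := 1) (e := 1)) => //; apply: homogX.
Qed.

Lemma unirational_sqrt_homog : unirational_sqrt \is 3.-homog.
Proof.
apply: (homogM (d := 1) (e := 2)) => //; first exact: homogX.
rewrite rpredD //; first exact: homogXn.
exact/homogC/homogXn.
Qed.

Lemma unirational_map_homog :
  exists d e : nat,
    (forall i, unirational_map (xv i) \is d.-homog) /\
    (forall j, (twist j * d <= e)%N /\ unirational_map (yv j) \is (e - twist j * d).-homog).
Proof.
have xh d (p : {mpoly k[2]}) : p \is d.-homog ->
    mmap (@mpolyC 6 k) unirational_base p \is (3 * d).-homog.
  by move=> /dhomog_mmap; apply; apply: unirational_base_homog.
(* Here w has degree 3 and m degree 9, so y_0 has degree 1 + 12 = 13 = 22 - 9, y_1 has degree 1 + 18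
   = 19 = 22 - 3, and W has degree 3 + 19 = 9 + 13 = 22. *)
exists 3%N, 22%N; split=> [i|j].
  by rewrite /unirational_map /fiber_point bundle_point_xv unirational_base_homog.
rewrite /unirational_map /fiber_point bundle_point_yv.
set w := unirational_sqrt; set rho := 'X_(@Ordinal 6 3 isT).
set m := 'X__ * _ ^+ 8; set y0 := rho * _ *+ 2; set y1 := rho * _.
have wh : w \is 3.-homog := unirational_sqrt_homog.
have mh : m \is 9.-homog.
  by apply: (homogM (d := 1) (e := 8)) => //; [apply: homogX | exact: homogXn].
have y0h : y0 \is 13.-homog.
  rewrite rpredMn //; apply: (homogM (d := 1) (e := 12)) => //; first exact: homogX.
  by rewrite rpredB ?(xh 4%N) ?form_b_homog ?(homogM wh mh).
have y1h : y1 \is 19.-homog.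
  apply: (homogM (d := 1) (e := 18)) => //; first exact: homogX.
  by rewrite rpredB ?(xh 6%N) ?form_a_homog // (dhomogMn 2 mh).
case: j => [[|[|[|//]]] lt]; split=> //=.
apply: homogC; rewrite (_ : (22 - _)%N = 22%N) //.
rewrite !rpredB ?rpredD //.
- exact: homogM wh y1h _.
- exact: homogM mh y0h _.
- exact: homogM (xh _ _ (s02_homog s)) y0h _.
- exact: homogM (xh _ _ (s12_homog s)) y1h _.
Qed.

(** A polynomial is nonzero if one value is. At sg = 0, tau = lam = rho = 1 the base point is a and
    w = 1; the slope m = b(x) + 1, with b denoting [form_b], then gives y_0 = 2. *)
Lemma unirational_map_relevant : relevant unirational_map.
Proof.
pose f : {rmorphism k -> k} := idfun.
pose x := base_point f 1 0.
pose m := mmap f x (form_b s) + 1.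
have E := mmap_unirational_map f 0 1 1 1 m.
rewrite !expr0n expr1n !mulr0 !mul1r subr0 addr0 mul0rn -/x in E.
split.
  have : (a 0 != 0) || (a 1 != 0).
    apply: contraT; rewrite negb_or !negbK => /andP[/eqP a00 /eqP a10].
    by case/eqP: two_neq0; rewrite -ab_det a00 a10 !mul0r subr0.
  case/orP => ai; [exists 0 | exists 1];
    apply: (mmap_neq0 (f := f) (v := parameters 0 1 1 1 m));
    by rewrite [mmap _ _ _]E /fiber_point bundle_point_xv /x /base_point mul0r addr0 mul1r.
exists (@Ordinal 3 0 isT).
apply: (mmap_neq0 (f := f) (v := parameters 0 1 1 1 m)).
rewrite [mmap _ _ _]E /fiber_point bundle_point_yv /= !mul1r /m.
by rewrite (addrC _ 1) addrK.
Qed.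

Lemma unirational_map_rational : rational_map (conic_equation s) unirational_map.
Proof.
split; [exact: unirational_map_homog|exact: unirational_map_relevant|].
exact: unirational_map_on_conic.
Qed.

(** * Density of the image *)

Section Dominant.

Variable F : {mpoly k[2 + 3]}.
Hypothesis F_image : mmap (@mpolyC 6 k) unirational_map F = 0.
Variables (L : fieldType) (iota : {rmorphism k -> L}).

(** Stereographic projection inverts the parametrization of the base conic where w + X is nonzero:
    take sg = Y, tau = w + X and lam = 1 / (2 (w + X)). Such points are therefore in the image. *)
Lemma fiber_point_vanish (X Y w m rho : L) :
  w ^+ 2 = X ^+ 2 + iota gam * Y ^+ 2 -> w + X != 0 ->
  mmap iota (fiber_point iota (base_point iota X Y) w m rho) F = 0.
Proof.
move=> wXY wX0.
have two0 : 2%:R != 0 :> L by rewrite -(rmorph_nat iota) fmorph_eq0.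
pose lam := (2%:R * (w + X))^-1.
have := congr1 (mmap iota (parameters Y (w + X) lam rho m)) F_image.
rewrite rmorph0 mmap_comp => <-; apply: eq_mmap => i.
rewrite [RHS]mmap_unirational_map.
have gY : iota gam * Y ^+ 2 = (w + X) * (w - X).
  by rewrite -[LHS](addKr (X ^+ 2)) -wXY; ring.
have ->: lam * ((w + X) ^+ 2 + iota gam * Y ^+ 2) = w.
  by rewrite gY /lam; field; rewrite wX0 two0.
apply: eq_fiber_point => j; rewrite /base_point gY; congr (_ * _ + _ * _).
  by rewrite /lam; field; rewrite wX0 two0.
by rewrite /lam; field; rewrite wX0 two0.
Qed.

(** The order Y, X, y_0, y_1 is the order in which the dense family of points is chosen; W comes
    last, as in [splits_on]. *)
Definition chart_point (u : L * L * L * L * L) : 'I_(2 + 3) -> L :=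
  let: (Y, X, y0, y1, W) := u in
  bundle_point s iota (base_point iota X Y) y0 y1 W.

Definition chart_cover (v : L * L * L * L) : L :=
  let: (Y, X, y0, y1) := v in double_cover s iota (base_point iota X Y) y0 y1.

Lemma chart_form_polyfun (p : {mpoly k[2]}) :
  polyfun4 (fun v => let: (Y, X, _, _) := v in mmap iota (base_point iota X Y) p).
Proof.
have [Pext Pc PD PM] := polyfun4_subalgebra L.
pose h (v : L * L * L * L) := base_point iota v.1.1.2 v.1.1.1.
apply: (Pext (fun v => mmap iota (h v) p)); first by move=> [[[Y X] y0] y1].
apply: subalgebra_mmap; first exact: polyfun4_subalgebra.
have [_ Pc1 _ _] := polyfun_subalgebra L; have Pid := polyfun_id L.
move=> i; rewrite /h /base_point; apply: PD; apply: PM; try exact: Pc.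
  by move=> a1 a2 a3 a4; split=> //=; apply: Pc1.
by move=> a1 a2 a3 a4; split=> //=; apply: Pc1.
Qed.

Lemma polyfun4_y0 : polyfun4 (fun v : L * L * L * L => v.1.2).
Proof.
have [_ Pc1 _ _] := polyfun_subalgebra L; have Pid := polyfun_id L.
by move=> a1 a2 a3 a4; split=> //=; apply: Pc1.
Qed.

Lemma polyfun4_y1 : polyfun4 (fun v : L * L * L * L => v.2).
Proof.
have [_ Pc1 _ _] := polyfun_subalgebra L; have Pid := polyfun_id L.
by move=> a1 a2 a3 a4; split=> //=; apply: Pc1.
Qed.

Lemma chart_cover_polyfun : polyfun4 chart_cover.
Proof.
have [Pext Pc PD PM] := polyfun4_subalgebra L.
have P0 := polyfun4_y0; have P1 := polyfun4_y1; have Pf := chart_form_polyfun.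
apply: (Pext) (PD _ _ (PD _ _ (PM _ _ (Pf (form_a s)) (PM _ _ P0 P0))
  (PM _ _ (PM _ _ (Pc 2%:R) (Pf (form_b s))) (PM _ _ P0 P1)))
  (PM _ _ (Pf (form_d s)) (PM _ _ P1 P1))) => [[[[Y X] y0] y1]].
by rewrite /chart_cover /double_cover /= !expr2.
Qed.

(** The coordinates x_i, y_0, y_1 do not involve W, and y_2 is affine in W; a polynomial in them
    reduces modulo the equation of the cover. *)
Lemma chart_splits : splits_on chart_cover (fun u => mmap iota (chart_point u) F).
Proof.
have [S4 SW Ssub] := splits_on_subalgebra chart_cover_polyfun.
have [Sext Sc SD SM] := Ssub.
apply: subalgebra_mmap => // i; rewrite -(splitK i).
case: (split i) => j /=.
  have Pj := chart_form_polyfun 'X_j.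
  apply: Sext (S4 _ Pj) => [[[[[Y X] y0] y1] W]] /=.
  by rewrite -/(xv j) bundle_point_xv mmapX mmap1U.
have Pf p := S4 _ (chart_form_polyfun p).
have S0 := S4 _ polyfun4_y0; have S1 := S4 _ polyfun4_y1.
have yE Y X y0 y1 W := bundle_point_yv s iota (base_point iota X Y) y0 y1 W j.
case: j yE => [[|[|[|//]]] lt] yE.
- by apply: (Sext) S0 => [[[[[Y X] y0] y1] W]]; rewrite /chart_point yE.
- by apply: (Sext) S1 => [[[[[Y X] y0] y1] W]]; rewrite /chart_point yE.
apply: (Sext) (SM _ _ (Sc (iota (2%:R * c22 s)^-1)) (SD _ _ SW
  (SM _ _ (Sc (-1)) (SD _ _ (SM _ _ (Pf (s02 s)) S0) (SM _ _ (Pf (s12 s)) S1))))) => u.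
case: u => [[[[Y X] y0] y1] W]; rewrite /chart_point yE /=; ring.
Qed.

(* Replacing (w, m) by (- w, - m) fixes y0 and y1 and changes the sign of W. *)
Lemma chart_dense :
  infinite_field L ->
  infinitely_many (fun Y => infinitely_many (fun X =>
    infinitely_many (fun y0 => infinitely_many (fun y1 =>
      exists2 W, W != 0 & W ^+ 2 = chart_cover (Y, X, y0, y1) /\
        (mmap iota (chart_point (Y, X, y0, y1, W)) F = 0 /\
         mmap iota (chart_point (Y, X, y0, y1, - W)) F = 0))))).
Proof.
move=> infL.
have two0 : 2%:R != 0 :> L by rewrite -(rmorph_nat iota) fmorph_eq0.
have gamL : iota gam != 0 by rewrite fmorph_eq0.
have inf_neq0 : infinitely_many (fun c : L => c != 0).
  by move=> r; have [c] := infL (0 :: r); rewrite inE negb_or => /andP[]; exists c.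
apply: infinitely_many_mono (inf_neq0) => Y Y0.
set g := iota gam * Y ^+ 2.
have g0 : g != 0 by rewrite mulf_neq0 ?expf_neq0.
(* Factor w^2 - X^2 = g with w - X = r and w + X = g / r: then X = (g - r^2) / (2 r) and w = (g +
   r^2) / (2 r). The polynomial [q] keeps w nonzero. *)
have := infinitely_many_ratios (f := quad g 0 (-1)) (g := quad 0 2%:R 0)
  (q := quad g 0 1) infL.
rewrite !quad_neq0 ?two0 ?oner_eq0 ?orbT // => /(_ isT isT) infX.
apply: infinitely_many_mono (infX _) => [X [r]|c]; last first.
  by rewrite quad_sub quad_neq0 // mulr0 subr0 oppr_eq0 oner_eq0 orbT.
rewrite !quad_horner !mul0r !add0r !addr0 mulN1r mul1r mulf_eq0 negb_or.
move=> [/andP[_ r0] gr XE].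
pose w := (g + r ^+ 2) / (2%:R * r).
have w0 : w != 0 by apply: mulf_neq0 => //; rewrite invr_eq0; apply: mulf_neq0.
have wXY : w ^+ 2 = X ^+ 2 + g by rewrite /w XE; field; rewrite r0 two0.
have wX0 : w + X != 0.
  rewrite (_ : w + X = g / r); first by apply: mulf_neq0 => //; rewrite invr_eq0.
  by rewrite /w XE; field; rewrite r0 two0.
have wX0' : - w + X != 0.
  rewrite (_ : - w + X = - r); first by rewrite oppr_eq0.
  by rewrite /w XE; field; rewrite r0 two0.
clearbody w; apply: infinitely_many_mono inf_neq0 => y0 y00.
set x := base_point iota X Y.
set A := mmap iota x (form_a s); set B := mmap iota x (form_b s).
(* For fixed y_0, y_1 = y_0 (A - m^2) / (2 (w m - B)) is a nonconstant function of the slope m. The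
   polynomial [q] is W / rho, so its nonvanishing gives W nonzero. *)
have := infinitely_many_ratios (f := quad (y0 * A) 0 (- y0))
  (g := quad (- (2%:R * B)) (2%:R * w) 0) (q := quad (w * A) (- (2%:R * B)) w) infL.
rewrite !quad_neq0 ?(mulf_neq0 two0 w0) ?w0 ?orbT // => /(_ isT isT) infy1.
apply: infinitely_many_mono (infy1 _) => [y1 [m]|c]; last first.
  by rewrite quad_sub quad_neq0 // mulr0 subr0 oppr_eq0 y00 orbT.
rewrite !quad_horner !mul0r !addr0 => [[gm qm y1E]].
set gm' := (X in X != 0) in gm; pose rho := y0 / gm'.
have y0E : rho * (w * m - B) *+ 2 = y0.
  by rewrite -[RHS](divfK gm) -/rho /gm'; ring.
have y1E' : rho * (A - m ^+ 2) = y1.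
  by rewrite y1E -/gm' /rho; field.
exists (w * y1 + m * y0).
  have -> : w * y1 + m * y0 = rho * (w * A + - (2%:R * B) * m + w * m ^+ 2).
    by rewrite -y1E' -[X in m * X]y0E; ring.
  by apply: mulf_neq0 => //; apply: mulf_neq0 => //; rewrite invr_eq0.
have dE : mmap iota x (form_d s) = w ^+ 2 by rewrite /x form_dE wXY.
split.
  by rewrite /chart_cover /double_cover -/x -/A -/B dE -y1E' -y0E; ring.
split.
  have := fiber_point_vanish m rho wXY wX0.
  by rewrite /fiber_point -/x -/A -/B y0E y1E'.
have := @fiber_point_vanish X Y (- w) (- m) rho; rewrite sqrrN => /(_ wXY wX0').
rewrite /fiber_point -/x -/A -/B mulrNN sqrrN y0E y1E' => <-.
by rewrite /chart_point -/x; congr (mmap _ (bundle_point _ _ _ _ _ _) _); ring.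
Qed.

(** Cramer's rule, as the basis a, b has determinant 2, invertible in L. *)
Lemma base_pointE (x : 'I_2 -> L) : exists X Y, x =1 base_point iota X Y.
Proof.
have two0 : 2%:R != 0 :> L by rewrite -(rmorph_nat iota) fmorph_eq0.
have detL : iota (a 0) * iota (b 1) - iota (a 1) * iota (b 0) = 2%:R.
  by rewrite -!rmorphM -rmorphB ab_det rmorph_nat.
exists ((x 0 * iota (b 1) - x 1 * iota (b 0)) / 2%:R),
       ((x 1 * iota (a 0) - x 0 * iota (a 1)) / 2%:R) => i.
rewrite /base_point; apply: (mulfI two0).
have: (i == 0) || (i == 1) by case: i => [[|[|//]] lt].
case/orP => /eqP->; rewrite -{1}detL; field; exact: two0.
Qed.

Lemma vanishes_on_conic (v : 'I_(2 + 3) -> L) :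
  infinite_field L -> mmap iota v (conic_equation s) = 0 -> mmap iota v F = 0.
Proof.
move=> infL Qv.
have two0 : 2%:R != 0 :> L by rewrite -(rmorph_nat iota) fmorph_eq0.
have [E [O [PE PO EO]]] := chart_splits.
(* Adding and subtracting the values at W and - W gives 2 E = 0 and 2 W O = 0. *)
have EO0 Y X y0 y1 W : W != 0 -> W ^+ 2 = chart_cover (Y, X, y0, y1) ->
    mmap iota (chart_point (Y, X, y0, y1, W)) F = 0 ->
    mmap iota (chart_point (Y, X, y0, y1, - W)) F = 0 ->
    E (Y, X, y0, y1) = 0 /\ O (Y, X, y0, y1) = 0.
  move=> W0 WD; rewrite !EO ?sqrrN // => EWO EWO'; split.
    apply: (mulfI two0); rewrite mulr0 -[RHS](addr0 0) -{1}EWO -EWO'; ring.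
  apply: (mulfI (mulf_neq0 two0 W0)); rewrite mulr0 -[RHS](subr0 0) -{1}EWO -EWO'; ring.
have dense := chart_dense infL.
have E0 : forall u, E u = 0.
  apply: polyfun4_eq0 => //.
  apply: infinitely_many_mono dense => Y; apply: infinitely_many_mono => X.
  apply: infinitely_many_mono => y0; apply: infinitely_many_mono => y1.
  by move=> [W W0 [WD [FW FW']]]; have [] := EO0 _ _ _ _ _ W0 WD FW FW'.
have O0 : forall u, O u = 0.
  apply: polyfun4_eq0 => //.
  apply: infinitely_many_mono dense => Y; apply: infinitely_many_mono => X.
  apply: infinitely_many_mono => y0; apply: infinitely_many_mono => y1.
  by move=> [W W0 [WD [FW FW']]]; have [] := EO0 _ _ _ _ _ W0 WD FW FW'.
(* Every point of the hypersurface has chart coordinates, whether or not d is a square there, so the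
   vanishing of E and O settles it. *)
have [W [WD vE]] := on_conic_bundle_point two_c22 Qv.
have [X [Y xE]] := base_pointE (v \o xv).
pose u := (Y, X, v y0v, v y1v).
have vE' : v =1 chart_point (u, W).
  move=> i; rewrite vE /u /bundle_point !(eq_mmap iota xE) /chart_point /bundle_point.
  by case: (split i) => [j|//]; exact: (xE j).
rewrite (eq_mmap iota vE') EO ?E0 ?O0 ?mulr0 ?addr0 //.
by rewrite WD /double_cover !(eq_mmap iota xE).
Qed.

End Dominant.

Lemma unirational_map_dominant :
  infinite_field k -> dominant (conic_equation s) unirational_map.
Proof.
move=> infk F _ F0 L iota v [_ Qv].
by apply: vanishes_on_conic => //; apply: infinite_field_extension iota infk.
Qed.

End Param.

(** * The general conic bundle *)

(* Coefficients of x_0^2, x_0 x_1 and x_1^2 in s12^2 - 4 s22 s11. In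
   [conic_coords], positions 16-18 hold s11, 19-20 hold s12, and 21 holds s22. *)
Definition cover_coef0 (R : comNzRingType) (v : 'I_22 -> R) : R :=
  v (@Ordinal 22 19 isT) ^+ 2 - v (@Ordinal 22 21 isT) * v (@Ordinal 22 16 isT) *+ 4.
Definition cover_coef1 (R : comNzRingType) (v : 'I_22 -> R) : R :=
  v (@Ordinal 22 19 isT) * v (@Ordinal 22 20 isT) *+ 2
  - v (@Ordinal 22 21 isT) * v (@Ordinal 22 17 isT) *+ 4.
Definition cover_coef2 (R : comNzRingType) (v : 'I_22 -> R) : R :=
  v (@Ordinal 22 20 isT) ^+ 2 - v (@Ordinal 22 21 isT) * v (@Ordinal 22 18 isT) *+ 4.

(** Over a field of characteristic other than 2, its nonvanishing means that the conic w^2 = d(x) is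
    smooth. *)
Definition cover_disc (R : comNzRingType) (v : 'I_22 -> R) : R :=
  cover_coef1 v ^+ 2 - cover_coef0 v * cover_coef2 v *+ 4.

Definition cover_disc_form (k : fieldType) : {mpoly k[22]} := cover_disc (fun i => 'X_i).

Lemma cover_disc_form_homog (k : fieldType) : cover_disc_form k \is 4.-homog.
Proof.
have XX i j : ('X_i * 'X_j : {mpoly k[22]}) \is 2.-homog.
  exact: dhomogM (homogX _ _) (homogX _ _).
have h0 : cover_coef0 (fun i => 'X_i : {mpoly k[22]}) \is 2.-homog.
  by rewrite rpredB ?rpredMn ?homogXn ?XX.
have h1 : cover_coef1 (fun i => 'X_i : {mpoly k[22]}) \is 2.-homog.
  by rewrite rpredB ?rpredMn ?XX.
have h2 : cover_coef2 (fun i => 'X_i : {mpoly k[22]}) \is 2.-homog.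
  by rewrite rpredB ?rpredMn ?homogXn ?XX.
rewrite rpredB ?(dhomogMn 2 h1) // rpredMn //; exact: dhomogM h0 h2.
Qed.

Lemma rmorph_cover_disc (R S : comNzRingType) (g : {rmorphism R -> S}) (v : 'I_22 -> R) :
  g (cover_disc v) = cover_disc (g \o v).
Proof. by rewrite /cover_disc /cover_coef0 /cover_coef1 /cover_coef2 /=; ring. Qed.

Lemma cover_disc_formE (k : fieldType) (v : 'I_22 -> k) :
  (cover_disc_form k).@[v] = cover_disc v.
Proof.
rewrite [LHS]rmorph_cover_disc /cover_disc /cover_coef0 /cover_coef1 /cover_coef2 /=.
by rewrite !mevalXU.
Qed.

Section Coordinates.

Variables (k : fieldType) (s : conic_data k).
Let v := conic_coords s.

Lemma c22_coord : c22 s = v (@Ordinal 22 21 isT).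
Proof.
rewrite /c22 /v /conic_coords /=; congr (_@__); apply/mnmP => i.
by rewrite mnm0E; case: i => [[|[|//]] lt].
Qed.

Lemma mmap_s12 (R : comNzRingType) (f : {rmorphism k -> R}) x :
  mmap f x (s12 s) = f (v (@Ordinal 22 19 isT)) * x 0 + f (v (@Ordinal 22 20 isT)) * x 1.
Proof.
rewrite (mmap_binary_form f x (s12_homog s)) !big_ord_recl big_ord0 /=.
by rewrite !expr0 !expr1 mulr1 mul1r addr0.
Qed.

Lemma mmap_s11 (R : comNzRingType) (f : {rmorphism k -> R}) x :
  mmap f x (s11 s) = f (v (@Ordinal 22 16 isT)) * x 0 ^+ 2
    + f (v (@Ordinal 22 17 isT)) * (x 0 * x 1) + f (v (@Ordinal 22 18 isT)) * x 1 ^+ 2.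
Proof.
rewrite (mmap_binary_form f x (s11_homog s)) !big_ord_recl big_ord0 /=.
by rewrite !expr0 !expr1 mulr1 mul1r addr0 addrA.
Qed.

Lemma mmap_form_d_coords (R : comNzRingType) (f : {rmorphism k -> R}) x :
  mmap f x (form_d s) = f (cover_coef0 v) * x 0 ^+ 2
    + f (cover_coef1 v) * (x 0 * x 1) + f (cover_coef2 v) * x 1 ^+ 2.
Proof.
rewrite mmap_form_d mmap_s12 mmap_s11 c22_coord.
by rewrite /cover_coef0 /cover_coef1 /cover_coef2; ring.
Qed.

(** If s22 = 0, then d = s12^2 is the square of a linear form and has discriminant 0. *)
Lemma smooth_cover_c22_neq0 : cover_disc v != 0 -> c22 s != 0.
Proof.
rewrite c22_coord; apply: contraNneq => c0.
by rewrite /cover_disc /cover_coef0 /cover_coef1 /cover_coef2 c0; apply/eqP; ring.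
Qed.

Lemma smooth_cover_unirational :
  infinite_field k -> C1_field k -> 2%:R != 0 :> k -> cover_disc v != 0 ->
  unirational (conic_equation s).
Proof.
move=> infk C1 two0 disc.
have two_c22 : 2%:R * c22 s != 0 by rewrite mulf_neq0 // smooth_cover_c22_neq0.
set d0 := cover_coef0 v; set d1 := cover_coef1 v; set d2 := cover_coef2 v.
have disc' : d1 ^+ 2 - 4%:R * d0 * d2 != 0.
  by rewrite -mulrA mulr_natl.
have [a0 [a1 aE]] := C1_represents_one C1 disc'.
(* [b] spans the orthogonal complement of [a] for the polar form. *)
pose b0 := - (d1 * a0 + 2%:R * d2 * a1); pose b1 := 2%:R * d0 * a0 + d1 * a1.
pose a (i : 'I_2) := nth 0 [:: a0; a1] i; pose b (i : 'I_2) := nth 0 [:: b0; b1] i.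
(* This is d(b): comparing Gram determinants in the basis a, b of determinant 2 gives d(a) d(b) = -
   (d1^2 - 4 d0 d2), and d(a) = 1. *)
pose gam := - (d1 ^+ 2 - 4%:R * d0 * d2).
have gam0 : gam != 0 by rewrite oppr_eq0.
have ab : a 0 * b 1 - a 1 * b 0 = 2%:R.
  transitivity (2%:R * (d0 * a0 ^+ 2 + d1 * (a0 * a1) + d2 * a1 ^+ 2)).
    by rewrite /a /b /b0 /b1 /=; ring.
  by rewrite aE mulr1.
have dE (R : comNzRingType) (f : {rmorphism k -> R}) X Y :
    mmap f (base_point a b f X Y) (form_d s) = X ^+ 2 + f gam * Y ^+ 2.
  rewrite mmap_form_d_coords -/d0 -/d1 -/d2 /base_point /a /b /=.
  (* Inserting the factor d(a) = 1 makes this a formal identity in a, X and Y. *)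
  transitivity (f (d0 * a0 ^+ 2 + d1 * (a0 * a1) + d2 * a1 ^+ 2) * (X ^+ 2 + f gam * Y ^+ 2)).
    by rewrite /gam /b0 /b1; ring.
  by rewrite aE rmorph1 mul1r.
exists 5%N, (unirational_map s a b gam); split.
  exact: unirational_map_rational.
exact: unirational_map_dominant.
Qed.

End Coordinates.

Unset Implicit Arguments.

Theorem proposition5p1 (k : fieldType) :
  infinite_field k -> C1_field k -> 2%N \notin [pchar k] ->
  general_conic_bundle (fun s : conic_data k => unirational (conic_equation s)).
Proof.
move=> infk C1 char2.
have two0 : 2%:R != 0 :> k by move: char2; rewrite inE.
(* The open set is the complement of the single hypersurface where the discriminant of d
   vanishes. *)
exists (fun v => proj_point v /\ exists2 F, F = cover_disc_form k & F.@[v] != 0); split.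
- exists (fun F => F = cover_disc_form k) => [F ->|//].
  by exists 4%N; apply: cover_disc_form_homog.
(* The point s11 = x_0 x_1, s22 = 1, all other forms zero: d = - 4 x_0 x_1 has discriminant 16 =
   2^4. *)
- exists (fun i => ((i == 17 :> nat) || (i == 21 :> nat))%:R); split.
    by exists (@Ordinal 22 21 isT); rewrite oner_eq0.
  exists (cover_disc_form k) => //; rewrite cover_disc_formE.
  rewrite (_ : cover_disc _ = 2%:R ^+ 4) ?expf_neq0 //.
  by rewrite /cover_disc /cover_coef0 /cover_coef1 /cover_coef2 /=; ring.
move=> s [_ [_ -> disc]]; apply: smooth_cover_unirational => //.
by rewrite -cover_disc_formE.
Qed.
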